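(* Let $\mathbf{P}\subset\mathbb{S}^{n_z+n_w}$ be a multiplier set for $\mathbf{\Delta}$, let $\mathbf{P}_n\subset\mathbb{S}^{1+hn_n}$ be a multiplier set for $\{n_\ast\}$, and let $$\mathbf{P}_{\mathcal D}:=\{\,W^\top P_nW: P_n\in\mathbf{P}_n\,\},\qquad W:=\begin{pmatrix} y_\ast&0 \\ x_\ast&0 \\ 0&I_{hn_n} \\ r_\ast&0\end{pmatrix}^{\!\top}\begin{pmatrix} 0&I \\ -\hat C_{hz}^\top&-\hat C_{hy}^\top \\ -\hat D_{hzn}^\top&-\hat D_{hyn}^\top \\ -\hat D_{hzr}^\top&-\hat D_{hyr}^\top\end{pmatrix}.$$ Suppose that $\sigma\in\{1,\dots,h\}$ is such that $$\ker(\hat D_{hyw})\subset\ker\begin{pmatrix}\hat B_{\sigma w}&0_{n_x\times(h-\sigma)n_w}\end{pmatrix}\quad\text{and}\quad\ker(\hat D_{hyw})\subset\ker\begin{pmatrix}\hat D_{\sigma ew}&0_{\sigma n_e\times(h-\sigma)n_w}\end{pmatrix},$$ and define, with $\hat D_{hyw}^+$ denoting the Moore-Penrose pseudoinverse of $\hat D_{hyw}$, $$M_b:=\begin{pmatrix}\hat B_{\sigma w}&0_{n_x\times(h-\sigma)n_w}\end{pmatrix}\hat D_{hyw}^+,\quad M_d:=\begin{pmatrix}\hat D_{\sigma ew}&0_{\sigma n_e\times(h-\sigma)n_w}\end{pmatrix}\hat D_{hyw}^+,\quad N:=\begin{pmatrix} I_{\sigma n_z}&0\end{pmatrix}\in\mathbb{R}^{\sigma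 n_z\times hn_z}.$$ Let $\gamma>0$. Then the feedback interconnection $$\begin{pmatrix} x(k+1) \\ z(k) \\ e(k) \\ y(k)\end{pmatrix}=\begin{pmatrix} A&B_w&B_n&B_r \\ C_z&D_{zw}&D_{zn}&D_{zr} \\ C_e&D_{ew}&D_{en}&D_{er} \\ C_y&D_{yw}&D_{yn}&D_{yr}\end{pmatrix}\begin{pmatrix} x(k) \\ w(k) \\ n(k) \\ r(k)\end{pmatrix},\qquad w(k)=\Delta_\ast z(k),$$ is stable and its energy gain $$\sup_{d\in\ell_2^{n_d}\setminus\{0\},\ x(0)=0}\frac{\|e\|_{\ell_2}}{\|d\|_{\ell_2}},\qquad d:=\begin{pmatrix} n \\ r\end{pmatrix},$$ is bounded by $\gamma$ if there exist matrices $X\in\mathbb{S}^{n_x}$ with $X\succ0$, $P=\begin{pmatrix} Q&S \\ S^\top&R\end{pmatrix}\in\mathbf{P}$ (with $Q\in\mathbb{S}^{n_z}$, $R\in\mathbb{S}^{n_w}$) and $P_{\mathcal D}\in\mathbf{P}_{\mathcal D}$ satisfying, with $\hat P:=\begin{pmatrix} I_\sigma\otimes Q&I_\sigma\otimes S \\ I_\sigma\otimes S^\top&I_\sigma\otimes R\end{pmatrix}$ and $P_\gamma:=\begin{pmatrix} I_{\sigma n_e}&0 \\ 0&-\gamma^2I_{\sigma n_d}\end{pmatrix}$, $$G^\top\,\mathrm{diag}(X,\,-X,\,\hat P,\,P_{\mathcal D},\,P_\gamma^{-1})\,G\succ0,\qquad G:=\begin{pmatrix} I&0&0 \\ -(A^\sigma)^\top&-\hat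 C_{\sigma z}^\top&-\hat C_{\sigma e}^\top \\ 0&I&0 \\ -\hat B_{\sigma w}^\top&-\hat D_{\sigma zw}^\top&-\hat D_{\sigma ew}^\top \\ 0&N^\top&0 \\ M_b^\top&0&M_d^\top \\ 0&0&I \\ -\hat B_{\sigma d}^\top&-\hat D_{\sigma zd}^\top&-\hat D_{\sigma ed}^\top\end{pmatrix}.$$
   Context: $\mathbb{S}^m$ denotes the set of real symmetric $m\times m$ matrices, $\otimes$ is the Kronecker product, $\succ0$ and $\preccurlyeq0$ denote positive definiteness and negative semidefiniteness, and $\ell_2^m$ is the space of square summable sequences $(s(k))_{k=0}^\infty$ in $\mathbb{R}^m$. System. All describing matrices are real of compatible dimensions, with state $x(k)\in\mathbb{R}^{n_x}$, interconnection signals $w(k)\in\mathbb{R}^{n_w}$, $z(k)\in\mathbb{R}^{n_z}$, noise $n(k)\in\mathbb{R}^{n_n}$, input $r(k)\in\mathbb{R}^{n_r}$, error $e(k)\in\mathbb{R}^{n_e}$ and measured output $y(k)\in\mathbb{R}^{n_y}$. The generalized disturbance is $d=\begin{pmatrix} n \\ r\end{pmatrix}$ with $n_d=n_n+n_r$, and $B_d:=(B_n\ B_r)$, $D_{zd}:=(D_{zn}\ D_{zr})$, $D_{ed}:=(D_{en}\ D_{er})$. The constant matrix $\Delta_\ast\in\mathbb{R}^{n_w\times n_z}$ is unknown, but belongs to a given set $\mathbf{\Delta}\subset\mathbb{R}^{n_w\times n_z}$. Stability. The interconnection is called stable if $I-D_{zw}\Delta_\ast$ is nonsingular and there exist $K,\alpha>0$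 such that $\|x(t)\|\le Ke^{-\alpha t}\|x(0)\|$ for all $t\ge0$, all $x(0)\in\mathbb{R}^{n_x}$ and for $d=0$. Multiplier set. For a set $\mathbf{U}\subset\mathbb{R}^{a\times b}$, a set $\mathbf{Q}\subset\mathbb{S}^{b+a}$ is called a (dual) multiplier set for $\mathbf{U}$ if $$\begin{pmatrix} -U^\top \\ I_a\end{pmatrix}^{\!\top}P\begin{pmatrix} -U^\top \\ I_a\end{pmatrix}\preccurlyeq0\quad\text{for all }(U,P)\in\mathbf{U}\times\mathbf{Q}$$ and if $\mathbf{Q}$ admits an LMI representation, i.e., there exist affine (symmetric) matrix-valued maps $E,F$ on some $\mathbb{R}^p$ with $\mathbf{Q}=\{E(\nu):\nu\in\mathbb{R}^p,\ F(\nu)\succ0\}$. This is used for $\mathbf{U}=\mathbf{\Delta}$ ($a=n_w$, $b=n_z$) and for $\mathbf{U}=\{n_\ast\}$ with $n_\ast\in\mathbb{R}^{hn_n}$ viewed as a column ($a=hn_n$, $b=1$). Data. $h\ge1$ is a given horizon length and $(x_\ast,r_\ast,y_\ast)\in\mathbb{R}^{n_x}\times\mathbb{R}^{hn_r}\times\mathbb{R}^{hn_y}$ is a given (known) trajectory generated by the interconnection under an unknown noise sequence $n_\ast\in\mathbb{R}^{hn_n}$: $r_\ast,y_\ast,n_\ast$ are the vertically stacked vectors of $r_\ast(k),y_\ast(k),n_\ast(k)$, $k=0,\dots,h-1$, and there exist signals $x,w,z$ satisfying the interconnection equations for $x$, $z$, $y$ and $w$ (with the true $\Delta_\ast$) for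 $k=0,\dots,h-1$ with $x(0)=x_\ast$, $n(k)=n_\ast(k)$, $r(k)=r_\ast(k)$, $y(k)=y_\ast(k)$. Lifted matrices. For every integer $k\ge1$, $i\in\{w,n,r,d\}$ and $o\in\{z,e,y\}$ (whenever the matrices involved are defined), $$\hat B_{ki}:=\begin{pmatrix} A^{k-1}B_i&A^{k-2}B_i&\cdots&B_i\end{pmatrix},\qquad \hat C_{ko}:=\begin{pmatrix} C_o \\ C_oA \\ \vdots \\ C_oA^{k-1}\end{pmatrix},$$ $$\hat D_{koi}:=\begin{pmatrix} D_{oi}&0&\cdots&0 \\ C_oB_i&D_{oi}&\ddots&\vdots \\ \vdots&\ddots&\ddots&0 \\ C_oA^{k-2}B_i&\cdots&C_oB_i&D_{oi}\end{pmatrix}$$ ($k\times k$ blocks). *)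

(* Defs.v *)
From mathcomp Require Import all_boot all_order all_algebra.
From mathcomp Require Import mxtens.
From mathcomp Require Import all_classical all_reals all_analysis.

Set Implicit Arguments.
Unset Strict Implicit.
Unset Printing Implicit Defensive.

Import Order.TTheory GRing.Theory Num.Theory.
Local Open Scope classical_set_scope.
Local Open Scope ring_scope.

Section Matrices.
Variable R : realType.

Definition symmx (m : nat) : set 'M[R]_m := [set M | M^T = M].

Definition posdefmx (m : nat) (M : 'M[R]_m) : Prop :=
  symmx M /\ forall v : 'cV[R]_m, v != 0 -> 0 < (v^T *m M *m v) 0 0.

Definition negsemidefmx (m : nat) (M : 'M[R]_m) : Prop :=
  symmx M /\ forall v : 'cV[R]_m, (v^T *m M *m v) 0 0 <= 0.

Definition rker (m n : nat) (M : 'M[R]_(m, n)) : set 'cV[R]_n :=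
  [set v | M *m v = 0].

Definition diag2_mx (m n : nat) (M : 'M[R]_m) (N : 'M[R]_n) : 'M[R]_(m + n) :=
  block_mx M 0 0 N.

(* Block index and offset of an entry are given by [mxtens_unindex], as in the
   Kronecker product [tensmx]. *)
Definition stack_col (k m n : nat) (B : 'I_k -> 'M[R]_(m, n)) :
    'M[R]_(k * m, n) :=
  \matrix_(i, j) B (mxtens_unindex i).1 (mxtens_unindex i).2 j.

Definition stack_row (k m n : nat) (B : 'I_k -> 'M[R]_(m, n)) :
    'M[R]_(m, k * n) :=
  \matrix_(i, j) B (mxtens_unindex j).1 i (mxtens_unindex j).2.

Definition stack_block (k m n : nat) (B : 'I_k -> 'I_k -> 'M[R]_(m, n)) :
    'M[R]_(k * m, k * n) :=
  \matrix_(i, j) B (mxtens_unindex i).1 (mxtens_unindex j).1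
                   (mxtens_unindex i).2 (mxtens_unindex j).2.

Lemma pad_dim (s h : nat) (hs : (s <= h)%N) (n : nat) :
  (s * n + (h - s) * n = h * n)%N.
Proof. by rewrite -mulnDl subnKC. Qed.

(* (M 0), completed to h blocks of n columns. *)
Definition pad_row (s h : nat) (hs : (s <= h)%N) (m n : nat)
    (M : 'M[R]_(m, s * n)) : 'M[R]_(m, h * n) :=
  castmx (erefl m, pad_dim hs n) (row_mx M (0 : 'M[R]_(m, (h - s) * n))).

Definition penrose (m n : nat) (M : 'M[R]_(m, n)) (X : 'M[R]_(n, m)) : Prop :=
  [/\ M *m X *m M = M, X *m M *m X = X,
      (M *m X)^T = M *m X & (X *m M)^T = X *m M].

(* The Moore-Penrose pseudoinverse; well defined by [penrose_mpinv] and
   [penrose_unique]. *)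
Definition mpinv (m n : nat) (M : 'M[R]_(m, n)) : 'M[R]_(n, m) :=
  xget 0 [set X | penrose M X].

Lemma penrose_unique (m n : nat) (M : 'M[R]_(m, n)) (X Y : 'M[R]_(n, m)) :
  penrose M X -> penrose M Y -> X = Y.
Proof.
move=> [a1 a2 a3 a4] [b1 b2 b3 b4].
have e1 : M *m X = M *m Y.
  rewrite -a3 -{1}b1 -(mulmxA (M *m Y)) trmx_mul a3 b3.
  by rewrite mulmxA a1.
have e2 : X *m M = Y *m M.
  rewrite -a4 -{1}b1 -[M *m Y *m M]mulmxA mulmxA trmx_mul a4 b4.
  by rewrite -mulmxA (mulmxA M) a1.
by rewrite -a2 e2 -mulmxA e1 mulmxA b2.
Qed.

Lemma gram_unitmx (m n : nat) (M : 'M[R]_(m, n)) :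
  row_free M -> M *m M^T \in unitmx.
Proof.
move=> fM; rewrite -row_free_unit -kermx_eq0; apply/rowV0P => v /sub_kermxP.
rewrite mulmxA => v0; have /eqP : v *m M *m (v *m M)^T = 0.
  by rewrite trmx_mul mulmxA v0 mul0mx.
move=> /eqP/matrixP/(_ 0 0); rewrite !mxE => /eqP.
rewrite psumr_eq0 => [/allP vM0|i _]; last by rewrite [_^T _ _]mxE -expr2 sqr_ge0.
have vM : v *m M = 0.
  apply/rowP => i; have := vM0 i (mem_index_enum i).
  by rewrite /= [_^T _ _]mxE -expr2 sqrf_eq0 => /eqP ->; rewrite mxE.
by apply: (row_free_inj fM); rewrite vM mul0mx.
Qed.

Lemma penrose_mpinv (m n : nat) (M : 'M[R]_(m, n)) : penrose M (mpinv M).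
Proof.
suff [X pX] : exists X, penrose M X by exact: (xgetPex 0 (ex_intro _ X pX)).
have [r [B [C [eM uC uB]]]] : exists r (B : 'M[R]_(m, r)) (C : 'M[R]_(r, n)),
    [/\ M = B *m C, C *m C^T \in unitmx & B^T *m B \in unitmx].
  exists (\rank M), (col_base M), (row_base M); split.
  - by rewrite mulmx_base.
  - exact/gram_unitmx/row_base_free.
  - rewrite -{2}[col_base M]trmxK; apply/gram_unitmx.
    by rewrite /row_free mxrank_tr; exact: col_base_full.
pose C' := C^T *m invmx (C *m C^T); pose B' := invmx (B^T *m B) *m B^T.
have CC : C *m C' = 1%:M by rewrite mulmxA mulmxV.
have BB : B' *m B = 1%:M by rewrite -mulmxA mulVmx.
have e1 : M *m (C' *m B') = B *m B'.
  by rewrite eM -mulmxA (mulmxA C) CC mul1mx.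
have e2 : C' *m B' *m M = C' *m C.
  by rewrite eM -mulmxA (mulmxA B') BB mul1mx.
exists (C' *m B'); split.
- by rewrite e1 eM -mulmxA (mulmxA B') BB mul1mx.
- by rewrite e2 -mulmxA (mulmxA C) CC mul1mx.
- by rewrite e1 /B' mulmxA !trmx_mul trmxK trmx_inv trmx_mul trmxK mulmxA.
- by rewrite e2 /C' !trmx_mul trmxK trmx_inv trmx_mul trmxK mulmxA.
Qed.

End Matrices.

Section Multipliers.
Variable R : realType.

Definition affine_symm_map (p m : nat) (f : 'cV[R]_p -> 'M[R]_m) : Prop :=
  (exists (L : {linear 'cV[R]_p -> 'M[R]_m}) (M0 : 'M[R]_m),
      forall v, f v = M0 + L v) /\
  (forall v, symmx (f v)).

Definition lmi_representable (m : nat) (Qs : set 'M[R]_m) : Prop :=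
  exists (p q : nat) (E : 'cV[R]_p -> 'M[R]_m) (F : 'cV[R]_p -> 'M[R]_q),
    [/\ affine_symm_map E, affine_symm_map F &
        Qs = [set E v | v in [set v | posdefmx (F v)]]].

Definition multiplier_set (a b : nat) (Us : set 'M[R]_(a, b))
    (Qs : set 'M[R]_(b + a)) : Prop :=
  [/\ Qs `<=` @symmx R (b + a),
      (forall U P, Us U -> Qs P ->
         negsemidefmx ((col_mx (- U^T) 1%:M)^T *m P *m (col_mx (- U^T) 1%:M)))
    & lmi_representable Qs].

End Multipliers.

Section Signals.
Variable R : realType.

(* Euclidean norm (the library's matrix norm is the maximum norm). *)
Definition norm2 (m : nat) (v : 'cV[R]_m) : R :=
  Num.sqrt (\sum_(i < m) v i 0 ^+ 2).

(* Takes the value +oo on sequences that are not square summable. *)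
Definition l2norm (m : nat) (s : nat -> 'cV[R]_m) : \bar R :=
  sqrte (\sum_(0 <= k <oo) ((norm2 (s k)) ^+ 2)%:E)%E.

Definition ell2 (m : nat) : set (nat -> 'cV[R]_m) :=
  [set s | (l2norm s < +oo)%E].

End Signals.

Record plant (R : realType) (nx nw nz nn nr ne ny : nat) := Plant {
  mA : 'M[R]_nx;
  mBw : 'M[R]_(nx, nw); mBn : 'M[R]_(nx, nn); mBr : 'M[R]_(nx, nr);
  mCz : 'M[R]_(nz, nx);
  mDzw : 'M[R]_(nz, nw); mDzn : 'M[R]_(nz, nn); mDzr : 'M[R]_(nz, nr);
  mCe : 'M[R]_(ne, nx);
  mDew : 'M[R]_(ne, nw); mDen : 'M[R]_(ne, nn); mDer : 'M[R]_(ne, nr);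
  mCy : 'M[R]_(ny, nx);
  mDyw : 'M[R]_(ny, nw); mDyn : 'M[R]_(ny, nn); mDyr : 'M[R]_(ny, nr)
}.

Section Interconnection.
Variables (R : realType) (nx nw nz nn nr ne ny : nat).
Variables (G : plant R nx nw nz nn nr ne ny) (Delta : 'M[R]_(nw, nz)).

Definition mBd : 'M[R]_(nx, nn + nr) := row_mx (mBn G) (mBr G).
Definition mDzd : 'M[R]_(nz, nn + nr) := row_mx (mDzn G) (mDzr G).
Definition mDed : 'M[R]_(ne, nn + nr) := row_mx (mDen G) (mDer G).

Section Equations.
Variables (x : nat -> 'cV[R]_nx) (w : nat -> 'cV[R]_nw) (z : nat -> 'cV[R]_nz)
  (e : nat -> 'cV[R]_ne) (y : nat -> 'cV[R]_ny)
  (n : nat -> 'cV[R]_nn) (r : nat -> 'cV[R]_nr).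

Definition eq_x (k : nat) : Prop :=
  x k.+1 = mA G *m x k + mBw G *m w k + mBn G *m n k + mBr G *m r k.
Definition eq_z (k : nat) : Prop :=
  z k = mCz G *m x k + mDzw G *m w k + mDzn G *m n k + mDzr G *m r k.
Definition eq_e (k : nat) : Prop :=
  e k = mCe G *m x k + mDew G *m w k + mDen G *m n k + mDer G *m r k.
Definition eq_y (k : nat) : Prop :=
  y k = mCy G *m x k + mDyw G *m w k + mDyn G *m n k + mDyr G *m r k.
Definition eq_w (k : nat) : Prop := w k = Delta *m z k.

Definition interconnection : Prop :=
  forall k, [/\ eq_x k, eq_z k, eq_e k, eq_y k & eq_w k].

End Equations.

Definition stable : Prop :=
  (1%:M - mDzw G *m Delta) \in unitmx /\
  exists K alpha : R, [/\ 0 < K, 0 < alpha &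
    forall x w z e y, interconnection x w z e y (fun=> 0) (fun=> 0) ->
      forall t : nat, norm2 (x t) <= K * expR (- alpha * t%:R) * norm2 (x 0%N)].

(* d k = (n k; r k). *)
Definition energy_gain : \bar R :=
  ereal_sup [set g | exists (x : nat -> 'cV[R]_nx)
      (w : nat -> 'cV[R]_nw) (z : nat -> 'cV[R]_nz) (e : nat -> 'cV[R]_ne)
      (y : nat -> 'cV[R]_ny) (d : nat -> 'cV[R]_(nn + nr)),
    [/\ @ell2 R (nn + nr) d, d <> (fun=> 0), x 0%N = 0,
        interconnection x w z e y (fun k => usubmx (d k)) (fun k => dsubmx (d k))
      & g = (l2norm e / l2norm d)%E]].

Definition data_trajectory (h : nat) (xs : 'cV[R]_nx)
    (rs : 'cV[R]_(h * nr)) (ys : 'cV[R]_(h * ny)) (ns : 'cV[R]_(h * nn)) : Prop :=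
  exists (x : nat -> 'cV[R]_nx) (w : nat -> 'cV[R]_nw) (z : nat -> 'cV[R]_nz)
    (y : nat -> 'cV[R]_ny) (n : nat -> 'cV[R]_nn) (r : nat -> 'cV[R]_nr),
    [/\ x 0%N = xs,
        ns = stack_col (fun k : 'I_h => n k),
        rs = stack_col (fun k : 'I_h => r k),
        ys = stack_col (fun k : 'I_h => y k) &
        forall k, (k < h)%N ->
          [/\ eq_x x w n r k, eq_z x w z n r k, eq_y x w y n r k & eq_w w z k]].

End Interconnection.

Section Lifting.
Variable R : realType.

Definition hatB (k nx ni : nat) (A : 'M[R]_nx) (B : 'M[R]_(nx, ni)) :
    'M[R]_(nx, k * ni) :=
  stack_row (fun j : 'I_k => A ^+ (k - j.+1) *m B).

Definition hatC (k nx no : nat) (A : 'M[R]_nx) (C : 'M[R]_(no, nx)) :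
    'M[R]_(k * no, nx) :=
  stack_col (fun i : 'I_k => C *m A ^+ i).

Definition hatD (k nx ni no : nat) (A : 'M[R]_nx) (B : 'M[R]_(nx, ni))
    (C : 'M[R]_(no, nx)) (D : 'M[R]_(no, ni)) : 'M[R]_(k * no, k * ni) :=
  stack_block (fun i j : 'I_k =>
    if i == j then D
    else if (j < i)%N then C *m A ^+ (i - j.+1) *m B
    else 0).

End Lifting.

Section DataMultipliers.
Variables (R : realType) (nx nw nz nn nr ne ny : nat).
Variables (G : plant R nx nw nz nn nr ne ny) (h : nat).
Variables (xs : 'cV[R]_nx) (rs : 'cV[R]_(h * nr)) (ys : 'cV[R]_(h * ny)).

Definition dataW : 'M[R]_(1 + h * nn, h * nz + h * ny) :=
  (col_mx (row_mx ys 0)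
  (col_mx (row_mx xs 0)
  (col_mx (row_mx 0 1%:M)
          (row_mx rs 0))))^T *m
  col_mx (row_mx 0 1%:M)
  (col_mx (row_mx (- (hatC h (mA G) (mCz G))^T)
                  (- (hatC h (mA G) (mCy G))^T))
  (col_mx (row_mx (- (hatD h (mA G) (mBn G) (mCz G) (mDzn G))^T)
                  (- (hatD h (mA G) (mBn G) (mCy G) (mDyn G))^T))
          (row_mx (- (hatD h (mA G) (mBr G) (mCz G) (mDzr G))^T)
                  (- (hatD h (mA G) (mBr G) (mCy G) (mDyr G))^T)))).

Definition data_multipliers (Pn : set 'M[R]_(1 + h * nn)) :
    set 'M[R]_(h * nz + h * ny) :=
  [set dataW^T *m P *m dataW | P in Pn].

End DataMultipliers.

Section AnalysisLMI.
Variables (R : realType) (nx nw nz nn nr ne ny : nat).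
Variables (G : plant R nx nw nz nn nr ne ny).
Variables (h s : nat) (hs : (s <= h)%N).

Definition hatDhyw : 'M[R]_(h * ny, h * nw) :=
  hatD h (mA G) (mBw G) (mCy G) (mDyw G).

Definition padB : 'M[R]_(nx, h * nw) := pad_row hs (hatB s (mA G) (mBw G)).

Definition padD : 'M[R]_(s * ne, h * nw) :=
  pad_row hs (hatD s (mA G) (mBw G) (mCe G) (mDew G)).

Definition Mb : 'M[R]_(nx, h * ny) := padB *m mpinv hatDhyw.
Definition Md : 'M[R]_(s * ne, h * ny) := padD *m mpinv hatDhyw.
Definition Nmx : 'M[R]_(s * nz, h * nz) := pad_row hs 1%:M.

(* T is the lower right block of the multiplier (Q S; S^T T). *)
Definition lifted_multiplier (Q : 'M[R]_nz) (S : 'M[R]_(nz, nw)) (T : 'M[R]_nw) :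
    'M[R]_(s * nz + s * nw) :=
  block_mx (tensmx (1%:M : 'M[R]_s) Q) (tensmx (1%:M : 'M[R]_s) S)
           (tensmx (1%:M : 'M[R]_s) S^T) (tensmx (1%:M : 'M[R]_s) T).

Definition gain_multiplier (gamma : R) : 'M[R]_(s * ne + s * (nn + nr)) :=
  diag2_mx 1%:M (- gamma ^+ 2)%:M.

Definition outer_factor :
    'M[R]_(nx + (nx + ((s * nz + s * nw) + ((h * nz + h * ny) +
            (s * ne + s * (nn + nr))))),
           nx + (s * nz + s * ne)) :=
  col_mx (row_mx 1%:M (row_mx 0 0))
  (col_mx (row_mx (- (mA G ^+ s)^T)
             (row_mx (- (hatC s (mA G) (mCz G))^T)
                     (- (hatC s (mA G) (mCe G))^T)))
  (col_mx
    (col_mx (row_mx 0 (row_mx 1%:M 0))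
            (row_mx (- (hatB s (mA G) (mBw G))^T)
               (row_mx (- (hatD s (mA G) (mBw G) (mCz G) (mDzw G))^T)
                       (- (hatD s (mA G) (mBw G) (mCe G) (mDew G))^T))))
  (col_mx
    (col_mx (row_mx 0 (row_mx Nmx^T 0))
            (row_mx Mb^T (row_mx 0 Md^T)))
    (col_mx (row_mx 0 (row_mx 0 1%:M))
            (row_mx (- (hatB s (mA G) (mBd G))^T)
               (row_mx (- (hatD s (mA G) (mBd G) (mCz G) (mDzd G))^T)
                       (- (hatD s (mA G) (mBd G) (mCe G) (mDed G))^T))))))).

Definition analysis_lmi (gamma : R) (X : 'M[R]_nx) (Q : 'M[R]_nz)
    (S : 'M[R]_(nz, nw)) (T : 'M[R]_nw) (PD : 'M[R]_(h * nz + h * ny)) : Prop :=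
  posdefmx (outer_factor^T *m
    diag2_mx X (diag2_mx (- X) (diag2_mx (lifted_multiplier Q S T)
      (diag2_mx PD (invmx (gain_multiplier gamma))))) *m outer_factor).

End AnalysisLMI.

(* Main.v *)
Require Import Defs.
From mathcomp Require Import all_boot all_order all_algebra.
From mathcomp Require Import ring lra.
From mathcomp Require Import mxtens.
From mathcomp Require Import all_classical all_reals all_analysis.

Set Implicit Arguments.
Unset Strict Implicit.
Unset Printing Implicit Defensive.

Import Order.TTheory GRing.Theory Num.Theory.
Local Open Scope classical_set_scope.
Local Open Scope ring_scope.

(** The proof works on the dual (transposed) loop over one window of s steps.
Write D for the block diagonal matrix with s copies of Delta, and B_w, D_zw,
... for the lifted matrices of that window.  A triple (a, b, c) satisfies the
dual loop equation when b = D^T q with q = B_w^T a + D_zw^T b + D_ew^T c.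
The LMI, evaluated at (a, b, c), contains two multiplier terms.

The term of the lifted multiplier is a sum of s values of the form of P on the
range of (-Delta^T; 1), hence nonpositive ([lifted_multiplier_le0]).

The data term is nonpositive as well, and this is where the measured
trajectory enters.  Subtracting from the recorded outputs the response to
x_*, n_* and r_* leaves D_hyw w, while the response of z to the same data,
which is not measured, is z - D_hzw w.  The kernel inclusions mean that M_b
D_hyw and M_d D_hyw are the zero-padded B_w and D_ew ([mpinv_factor]); as
w = Delta z holds along the recorded signals, pairing the first vector with
M_b^T a + M_d^T c and the second with N^T b gives the same number
([data_pairing]).  This equality of scalars says exactly that W maps
(N^T b; M_b^T a + M_d^T c) into the range of (-n_*^T; 1), on which P_n is
negative semidefinite ([dataW_mul]).

What remains is a strict dissipation inequality for the dual loop
([lmi_dual_dissipation]).  At a = 0, c = 0 it forces the dual loop to have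
only the zero solution; a kernel vector of (1 - D_zw Delta)^T, placed in the
first block, would be a nonzero one, which gives well-posedness ([well_posed]).
Completing squares turns the dual inequality into the primal one,
    (1 + kappa) V(x(k+s)) + |e|^2 <= V(x(k)) + gamma^2 |d|^2
with V(x) = x^T X^-1 x and norms over a window ([primal_dissipation]).  For
d = 0 it makes V decay geometrically along multiples of s, and growth inside a
window is bounded ([sampled_exponential_decay]); summed over consecutive
windows from x(0) = 0 it bounds the energy gain. *)

(** * Quadratic forms on column vectors *)

Section QuadraticForms.
Variable R : realType.

Definition dotv m (u v : 'cV[R]_m) : R := (u^T *m v) 0 0.

Definition qform m (M : 'M[R]_m) (v : 'cV[R]_m) : R := dotv v (M *m v).

Lemma dotvE m (u v : 'cV[R]_m) : dotv u v = \sum_i u i 0 * v i 0.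
Proof. by rewrite /dotv mxE; apply: eq_bigr => i _; rewrite mxE. Qed.

Lemma dotvC m (u v : 'cV[R]_m) : dotv u v = dotv v u.
Proof. by rewrite !dotvE; apply: eq_bigr => i _; rewrite mulrC. Qed.

Lemma dotvDr m (u v w : 'cV[R]_m) : dotv u (v + w) = dotv u v + dotv u w.
Proof. by rewrite /dotv mulmxDr mxE. Qed.

Lemma dotvDl m (u v w : 'cV[R]_m) : dotv (u + v) w = dotv u w + dotv v w.
Proof. by rewrite dotvC dotvDr !(dotvC w). Qed.

Lemma dotvNr m (u v : 'cV[R]_m) : dotv u (- v) = - dotv u v.
Proof. by rewrite /dotv mulmxN mxE. Qed.

Lemma dotvNl m (u v : 'cV[R]_m) : dotv (- u) v = - dotv u v.
Proof. by rewrite dotvC dotvNr dotvC. Qed.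

Lemma dotvZr m a (u v : 'cV[R]_m) : dotv u (a *: v) = a * dotv u v.
Proof. by rewrite /dotv -scalemxAr mxE. Qed.

Lemma dotvZl m a (u v : 'cV[R]_m) : dotv (a *: u) v = a * dotv u v.
Proof. by rewrite dotvC dotvZr dotvC. Qed.

Lemma dot0v m (u : 'cV[R]_m) : dotv 0 u = 0.
Proof. by rewrite /dotv trmx0 mul0mx mxE. Qed.

Lemma dotv0 m (u : 'cV[R]_m) : dotv u 0 = 0.
Proof. by rewrite dotvC dot0v. Qed.

Lemma dotv_mulr m n (M : 'M[R]_(m, n)) u v : dotv u (M *m v) = dotv (M^T *m u) v.
Proof. by rewrite /dotv trmx_mul trmxK mulmxA. Qed.

Lemma dotv_mull m n (M : 'M[R]_(m, n)) u v : dotv (M *m u) v = dotv u (M^T *m v).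
Proof. by rewrite dotv_mulr trmxK. Qed.

Lemma dotv_ge0 m (u : 'cV[R]_m) : 0 <= dotv u u.
Proof. by rewrite dotvE sumr_ge0// => i _; rewrite -expr2 sqr_ge0. Qed.

Lemma dotv_eq0 m (u : 'cV[R]_m) : dotv u u = 0 -> u = 0.
Proof.
rewrite dotvE => /eqP; rewrite psumr_eq0; last first.
  by move=> i _; rewrite -expr2 sqr_ge0.
move=> /allP u0; apply/colP => i; have := u0 i (mem_index_enum i).
by rewrite /= -expr2 sqrf_eq0 mxE => /eqP.
Qed.

Lemma norm2E m (u : 'cV[R]_m) : norm2 u = Num.sqrt (dotv u u).
Proof. by rewrite dotvE /norm2; congr Num.sqrt; apply: eq_bigr. Qed.

Lemma sqr_norm2 m (u : 'cV[R]_m) : norm2 u ^+ 2 = dotv u u.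
Proof. by rewrite norm2E sqr_sqrtr ?dotv_ge0. Qed.

Lemma dotv_col m n (a c : 'cV[R]_m) (b d : 'cV[R]_n) :
  dotv (col_mx a b) (col_mx c d) = dotv a c + dotv b d.
Proof. by rewrite /dotv tr_col_mx mul_row_col mxE. Qed.

Lemma qform_diag2 m n (M : 'M[R]_m) (N : 'M[R]_n) a b :
  qform (diag2_mx M N) (col_mx a b) = qform M a + qform N b.
Proof.
by rewrite /qform mul_block_col !mul0mx addr0 add0r dotv_col.
Qed.

Lemma qformN m (M : 'M[R]_m) v : qform (- M) v = - qform M v.
Proof. by rewrite /qform mulNmx dotvNr. Qed.

Lemma qform_opp m (M : 'M[R]_m) v : qform M (- v) = qform M v.
Proof. by rewrite /qform mulmxN dotvNr dotvNl opprK. Qed.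

Lemma qform1 m (v : 'cV[R]_m) : qform 1%:M v = dotv v v.
Proof. by rewrite /qform mul1mx. Qed.

Lemma qform_congr m n (M : 'M[R]_m) (O : 'M[R]_(m, n)) v :
  qform (O^T *m M *m O) v = qform M (O *m v).
Proof. by rewrite /qform -!mulmxA dotv_mulr trmxK. Qed.

Lemma posdefmxE m (M : 'M[R]_m) v : posdefmx M -> v != 0 -> 0 < qform M v.
Proof. by move=> [_ pM] v0; rewrite /qform /dotv mulmxA; exact: pM. Qed.

Lemma posdef_ge0 m (M : 'M[R]_m) v : posdefmx M -> 0 <= qform M v.
Proof.
move=> pM; have [->|v0] := eqVneq v 0; last exact: ltW (posdefmxE pM v0).
by rewrite /qform dot0v.
Qed.

Lemma negsemidefmxE m (M : 'M[R]_m) v : negsemidefmx M -> qform M v <= 0.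
Proof. by move=> [_ nM]; rewrite /qform /dotv mulmxA; exact: nM. Qed.

(** Only the existence of some bound matters, so the entries of M are summed
    crudely; the normalization 1 <= c lets c serve as a growth rate. *)
Lemma qform_le m (M : 'M[R]_m) :
  exists2 c : R, 1 <= c & forall v, qform M v <= c * dotv v v.
Proof.
exists (1 + \sum_i \sum_j `|M i j|) => [|v].
  by rewrite lerDl sumr_ge0// => i _; apply: sumr_ge0.
have vi i : v i 0 ^+ 2 <= dotv v v.
  rewrite dotvE (bigD1 i)//= -expr2 lerDl sumr_ge0// => j _.
  by rewrite -expr2 sqr_ge0.
rewrite mulrDl mul1r -[leLHS]add0r; apply: lerD; first exact: dotv_ge0.
rewrite /qform dotvE mulr_suml; apply: ler_sum => i _.
rewrite mxE mulr_sumr mulr_suml; apply: ler_sum => j _.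
apply: (le_trans (ler_norm _)); rewrite !normrM mulrCA.
apply: ler_wpM2l => //.
have := vi i; have := vi j; rewrite -(real_normK (num_real (v i 0)))
  -(real_normK (num_real (v j 0))).
move: (`|v i 0|) (`|v j 0|) (dotv v v) => a b c hb ha.
have := sqr_ge0 (a - b); rewrite !expr2 in ha hb *; lra.
Qed.

Lemma mulmx_ker_unit m (M : 'M[R]_m) :
  (forall v : 'cV_m, M *m v = 0 -> v = 0) -> M \in unitmx.
Proof.
move=> kM; rewrite -unitmx_tr -row_free_unit -kermx_eq0; apply/rowV0P => v.
move=> /sub_kermxP /(congr1 trmx); rewrite trmx_mul trmxK trmx0 => /kM v0.
by rewrite -(trmxK v) v0 trmx0.
Qed.

Lemma posdef_unitmx m (M : 'M[R]_m) : posdefmx M -> M \in unitmx.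
Proof.
move=> pM; apply: mulmx_ker_unit => v Mv; apply/eqP/contraT => v0.
by have := posdefmxE pM v0; rewrite /qform Mv dotv0 ltxx.
Qed.

Lemma qform_inv m (M : 'M[R]_m) v :
  posdefmx M -> qform M (invmx M *m v) = qform (invmx M) v.
Proof.
by move=> pM; rewrite /qform mulKVmx ?posdef_unitmx// dotvC.
Qed.

Lemma posdef_inv m (M : 'M[R]_m) : posdefmx M -> posdefmx (invmx M).
Proof.
move=> pM; have uM := posdef_unitmx pM; split.
  by rewrite /symmx /= trmx_inv; case: pM => ->.
move=> v v0; rewrite -mulmxA -/(dotv _ _) -/(qform _ _) -qform_inv//.
apply: posdefmxE => //; apply: contra v0 => /eqP Mv.
by rewrite -(mulKVmx uM v) Mv mulmx0.
Qed.

Lemma qformB m (M : 'M[R]_m) u v : symmx M ->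
  qform M (u - v) = qform M u - dotv u (M *m v) *+ 2 + qform M v.
Proof.
move=> sM; rewrite /qform mulmxBr !dotvDl !dotvDr !dotvNl !dotvNr.
have -> : dotv v (M *m u) = dotv u (M *m v) by rewrite dotv_mulr sM dotvC.
by rewrite opprK mulr2n; ring.
Qed.

(** With c an upper bound for the form of the inverse of M, nonnegativity of
    M at v - c^-1 M^-1 v gives the lower bound c^-1. *)
Lemma posdef_coercive m (M : 'M[R]_m) : posdefmx M ->
  exists2 c : R, 0 < c & forall v, c * dotv v v <= qform M v.
Proof.
move=> pM; have [c c1 cP] := qform_le (invmx M).
have c0 : 0 < c by lra.
exists c^-1 => [|v]; first by rewrite invr_gt0.
have := posdef_ge0 (v - c^-1 *: (invmx M *m v)) pM.
rewrite (qformB _ _ pM.1) -!scalemxAr mulKVmx ?posdef_unitmx// dotvZr.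
have -> : qform M (c^-1 *: (invmx M *m v)) = c^-1 * (c^-1 * qform (invmx M) v).
  by rewrite -(qform_inv _ pM)/qform -scalemxAr dotvZl dotvZr.
have : c^-1 * qform (invmx M) v <= dotv v v.
  by rewrite mulrC ler_pdivrMr// mulrC.
move=> /(ler_wpM2l (ltW (_ : 0 < c^-1))); rewrite invr_gt0 => /(_ c0).
by move: (c^-1 * dotv v v) (c^-1 * _) => a b; rewrite mulr2n; lra.
Qed.

End QuadraticForms.

(** * Stacked signals *)

Section Stacking.
Variable R : realType.

Lemma sum_mxtens (k m : nat) (F : 'I_(k * m) -> R) :
  \sum_i F i = \sum_(p < k) \sum_(q < m) F (mxtens_index (p, q)).
Proof.
rewrite pair_bigA /= (reindex (@mxtens_index k m)) /=; last first.
  exists (@mxtens_unindex k m) => i _; [exact: mxtens_indexK|].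
  exact: mxtens_unindexK.
by apply: eq_bigr => -[].
Qed.

Lemma eq_stack_col k m n (f g : 'I_k -> 'M[R]_(m, n)) :
  f =1 g -> stack_col f = stack_col g.
Proof. by move=> fg; apply/matrixP => i j; rewrite !mxE fg. Qed.

Lemma stack_colD k m n (f g : 'I_k -> 'M[R]_(m, n)) :
  stack_col f + stack_col g = stack_col (fun i => f i + g i).
Proof. by apply/matrixP => i j; rewrite !mxE. Qed.

(** The blocks are indexed by all of nat (zero beyond k), so that a vector can
    be handled as the beginning of a signal. *)
Lemma stack_col_surj k m (v : 'cV[R]_(k * m)) :
  exists f : nat -> 'cV[R]_m, v = stack_col (fun i : 'I_k => f i).
Proof.
pose blk (i : 'I_k) : 'cV[R]_m := \col_j v (mxtens_index (i, j)) 0.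
exists (fun i => if insub i is Some i' then blk i' else 0).
apply/colP => i; rewrite !mxE valK mxE.
by rewrite -[i in LHS]mxtens_unindexK; case: (mxtens_unindex i).
Qed.

Lemma stack_row_mul k m n (B : 'I_k -> 'M[R]_(m, n)) (u : 'I_k -> 'cV[R]_n) :
  stack_row B *m stack_col u = \sum_j B j *m u j.
Proof.
apply/colP => i; rewrite mxE sum_mxtens summxE; apply: eq_bigr => p _.
by rewrite mxE; apply: eq_bigr => q _; rewrite !mxE mxtens_indexK.
Qed.

Lemma stack_block_mul k m n (B : 'I_k -> 'I_k -> 'M[R]_(m, n))
    (u : 'I_k -> 'cV[R]_n) :
  stack_block B *m stack_col u = stack_col (fun i => \sum_j B i j *m u j).
Proof.
apply/colP => i; rewrite !mxE sum_mxtens summxE; apply: eq_bigr => p _.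
by rewrite mxE; apply: eq_bigr => q _; rewrite !mxE mxtens_indexK.
Qed.

Lemma stack_col_mul k m n (C : 'I_k -> 'M[R]_(m, n)) (v : 'cV[R]_n) :
  stack_col C *m v = stack_col (fun i => C i *m v).
Proof.
by apply/colP => i; rewrite !mxE; apply: eq_bigr => q _; rewrite !mxE.
Qed.

Lemma tens1_mul k m n (M : 'M[R]_(m, n)) (u : 'I_k -> 'cV[R]_n) :
  tensmx (1%:M : 'M[R]_k) M *m stack_col u = stack_col (fun i => M *m u i).
Proof.
apply/colP => i; rewrite !mxE sum_mxtens.
rewrite (bigD1 (mxtens_unindex i).1)//= [X in _ + X]big1 ?addr0 => [|p pi].
  by apply: eq_bigr => q _; rewrite !mxE mxtens_indexK /= eqxx mul1r.
rewrite big1// => q _; rewrite !mxE mxtens_indexK /= eq_sym (negbTE pi).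
by rewrite !mul0r.
Qed.

Lemma dotv_stack k m (u v : 'I_k -> 'cV[R]_m) :
  dotv (stack_col u) (stack_col v) = \sum_i dotv (u i) (v i).
Proof.
rewrite dotvE sum_mxtens; apply: eq_bigr => p _; rewrite dotvE.
by apply: eq_bigr => q _; rewrite !mxE mxtens_indexK.
Qed.

(** The stacked signal is cut after s samples, where the zero padding starts;
    away from the cast between the two dimensions this is a block product. *)
Lemma pad_row_mul (s h : nat) (hs : (s <= h)%N) m n (M : 'M[R]_(m, s * n))
    (u : nat -> 'cV[R]_n) :
  pad_row hs M *m stack_col (fun i : 'I_h => u i)
  = M *m stack_col (fun i : 'I_s => u i).
Proof.
rewrite /pad_row.
have -> : stack_col (fun i : 'I_h => u i) =
  castmx (pad_dim hs n, erefl 1%N) (col_mx (stack_col (fun i : 'I_s => u i))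
    (stack_col (fun i : 'I_(h - s) => u (s + i)%N))).
  apply/colP => i; rewrite castmxE /= cast_ord_id [RHS]mxE.
  case: split_ordP => j ij; rewrite !mxE.
    have ij' : nat_of_ord i = j by have := congr1 val ij.
    congr (u _ _ _); first by rewrite /= ij'.
    by apply: val_inj; rewrite /= ij'.
  have ij' : nat_of_ord i = (s * n + j)%N by have := congr1 val ij.
  (* the quotient below needs n <> 0, which the index j provides *)
  have n0 : (0 < n)%N.
    have := leq_ltn_trans (leq0n j) (ltn_ord j); rewrite muln_gt0.
    by case/andP.
  congr (u _ _ _); first by rewrite /= ij' divnMDl.
  by apply: val_inj; rewrite /= ij' modnMDl.
case: _ / (pad_dim hs n) => /=.
by rewrite !castmx_id mul_row_col mul0mx addr0.
Qed.

End Stacking.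
(** * Lifted trajectories *)

Section Lifted.
Variables (R : realType) (nx : nat) (A : 'M[R]_nx).

(** The zero-state response of x(k+1) = A x(k) + f(k), at time k. *)
Definition forced (f : nat -> 'cV[R]_nx) (k : nat) : 'cV[R]_nx :=
  \sum_(j < k) A ^+ (k - j.+1) *m f j.

Lemma forcedS f k : forced f k.+1 = A *m forced f k + f k.
Proof.
rewrite /forced big_ord_recr /= subnn expr0 mul1mx; congr (_ + _).
rewrite mulmx_sumr; apply: eq_bigr => i _.
by rewrite subSn// exprS -mulmxE mulmxA.
Qed.

Lemma forcedD f g k : forced (fun i => f i + g i) k = forced f k + forced g k.
Proof. by rewrite /forced -big_split; apply: eq_bigr => i _; rewrite mulmxDr. Qed.

Lemma state_forced (x f : nat -> 'cV[R]_nx) K :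
  (forall k, (k < K)%N -> x k.+1 = A *m x k + f k) ->
  forall k, (k <= K)%N -> x k = A ^+ k *m x 0%N + forced f k.
Proof.
move=> xS; elim=> [_|k IH kK]; first by rewrite expr0 mul1mx /forced big_ord0 addr0.
rewrite xS// {1}IH ?(ltnW kK)// forcedS mulmxDr addrA.
by rewrite exprS -mulmxE mulmxA.
Qed.

Lemma hatB_stack ni k (B : 'M[R]_(nx, ni)) (u : nat -> 'cV[R]_ni) :
  hatB k A B *m stack_col (fun j : 'I_k => u j) = forced (fun j => B *m u j) k.
Proof.
by rewrite stack_row_mul; apply: eq_bigr => j _; rewrite mulmxA.
Qed.

Lemma hatC_mul no k (C : 'M[R]_(no, nx)) (x : 'cV[R]_nx) :
  hatC k A C *m x = stack_col (fun i : 'I_k => C *m (A ^+ i *m x)).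
Proof.
by rewrite stack_col_mul; apply: eq_stack_col => i; rewrite mulmxA.
Qed.

Lemma hatD_stack ni no k (B : 'M[R]_(nx, ni)) (C : 'M[R]_(no, nx))
    (D : 'M[R]_(no, ni)) (u : nat -> 'cV[R]_ni) :
  hatD k A B C D *m stack_col (fun j : 'I_k => u j) =
  stack_col (fun i : 'I_k => C *m forced (fun j => B *m u j) i + D *m u i).
Proof.
rewrite stack_block_mul; apply: eq_stack_col => i.
rewrite (bigD1 i)//= eqxx addrC; congr (_ + _).
rewrite /forced mulmx_sumr.
pose F j := C *m (A ^+ (i - j.+1) *m (B *m u j)).
rewrite (big_ord_widen k F) ?(ltnW (ltn_ord i))// {}/F.
rewrite [RHS]big_mkcond /= [LHS]big_mkcond /=; apply: eq_bigr => j _.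
rewrite (eq_sym i j) -(inj_eq val_inj j i) /=.
have [ji|ji|/val_inj ->] := ltngtP j i => //=; last by rewrite mul0mx.
by rewrite !mulmxA.
Qed.

Lemma hatD_row_mx n1 n2 no k (B1 : 'M[R]_(nx, n1)) (B2 : 'M[R]_(nx, n2))
    (C : 'M[R]_(no, nx)) (D1 : 'M[R]_(no, n1)) (D2 : 'M[R]_(no, n2))
    (u1 : nat -> 'cV[R]_n1) (u2 : nat -> 'cV[R]_n2) :
  hatD k A (row_mx B1 B2) C (row_mx D1 D2)
    *m stack_col (fun j : 'I_k => col_mx (u1 j) (u2 j))
  = hatD k A B1 C D1 *m stack_col (fun j : 'I_k => u1 j)
  + hatD k A B2 C D2 *m stack_col (fun j : 'I_k => u2 j).
Proof.
rewrite (hatD_stack _ _ _ _ (fun j => col_mx (u1 j) (u2 j))) !hatD_stack stack_colD.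
apply: eq_stack_col => i; rewrite mul_row_col addrACA -mulmxDr -forcedD.
congr (_ *m _ + _).
by apply: eq_bigr => j _; rewrite mul_row_col.
Qed.

Section TwoInputs.
Variables (n1 n2 K : nat) (B1 : 'M[R]_(nx, n1)) (B2 : 'M[R]_(nx, n2)).
Variables (x : nat -> 'cV[R]_nx) (u1 : nat -> 'cV[R]_n1) (u2 : nat -> 'cV[R]_n2).
Hypothesis xS : forall k, (k < K)%N -> x k.+1 = A *m x k + B1 *m u1 k + B2 *m u2 k.

Lemma lifted_state :
  x K = A ^+ K *m x 0%N + hatB K A B1 *m stack_col (fun j : 'I_K => u1 j)
        + hatB K A B2 *m stack_col (fun j : 'I_K => u2 j).
Proof.
rewrite !hatB_stack -addrA -forcedD; apply: (@state_forced x _ K) => // k kK.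
by rewrite addrA xS.
Qed.

Lemma lifted_output no (C : 'M[R]_(no, nx)) D1 D2 (o : nat -> 'cV[R]_no) :
  (forall k, (k < K)%N -> o k = C *m x k + D1 *m u1 k + D2 *m u2 k) ->
  stack_col (fun k : 'I_K => o k) =
  hatC K A C *m x 0%N + hatD K A B1 C D1 *m stack_col (fun j : 'I_K => u1 j)
        + hatD K A B2 C D2 *m stack_col (fun j : 'I_K => u2 j).
Proof.
move=> oE; rewrite hatC_mul !hatD_stack !stack_colD; apply: eq_stack_col => i.
have iK := ltnW (ltn_ord i).
rewrite oE// (@state_forced x (fun k => B1 *m u1 k + B2 *m u2 k) K)//.
  by rewrite forcedD !mulmxDr !addrA -!addrA; congr (_ + (_ + _)); rewrite addrCA.
by move=> k kK; rewrite addrA xS.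
Qed.

End TwoInputs.
End Lifted.

(** * From the dual to the primal inequality *)

(** Nonnegativity of the squared norm of a u - v / a. *)
Lemma scaled_square (R : realType) m (u v : 'cV[R]_m) (a : R) : 0 < a ->
  0 <= a ^+ 2 * dotv u u - dotv u v *+ 2 + a ^- 2 * dotv v v.
Proof.
move=> a0; have := dotv_ge0 (a *: u - a^-1 *: v).
rewrite !dotvDl !dotvDr !dotvNl !dotvNr !dotvZl !dotvZr (dotvC v u) !opprK.
rewrite !mulrA divff ?gt_eqF// mulVf ?gt_eqF// !mul1r -!expr2 exprVn mulr2n.
by rewrite opprD !addrA.
Qed.

Section Duality.
Variables (R : realType) (nx p q nd ne : nat).
Variables (A : 'M[R]_nx) (Bw : 'M[R]_(nx, p)) (Bd : 'M[R]_(nx, nd)).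
Variables (Cz : 'M[R]_(q, nx)) (Dzw : 'M[R]_(q, p)) (Dzd : 'M[R]_(q, nd)).
Variables (Ce : 'M[R]_(ne, nx)) (Dew : 'M[R]_(ne, p)) (Ded : 'M[R]_(ne, nd)).
Variables (Dl : 'M[R]_(p, q)) (X : 'M[R]_nx) (gamma eps : R).

(** The equation b = Dl^T q of the transposed loop, q being the output
    through which the transposed plant feeds Dl^T. *)
Definition dual_interconnected (a : 'cV[R]_nx) (b : 'cV[R]_q) (c : 'cV[R]_ne) :=
  b = Dl^T *m (Bw^T *m a + Dzw^T *m b + Dew^T *m c).

(** Dissipativity of the transposed loop, which maps (a, c) to the two vectors
    on the left; the margin in eps keeps what is needed of strictness: the part
    in b makes the loop well-posed, the part in a yields the decay rate. *)
Definition dual_dissipation : Prop := forall a b c, dual_interconnected a b c ->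
  qform X (A^T *m a + Cz^T *m b + Ce^T *m c)
  + gamma ^- 2 * (dotv (Bd^T *m a + Dzd^T *m b + Ded^T *m c)
                       (Bd^T *m a + Dzd^T *m b + Ded^T *m c))
  + eps * (dotv a a + dotv b b) <= qform X a + dotv c c.

Hypotheses (pX : posdefmx X) (gamma_gt0 : 0 < gamma) (eps_gt0 : 0 < eps).
Hypothesis dual : dual_dissipation.

(** For a = 0 and c = 0 the right-hand side of the dissipation inequality is
    zero, while each term on the left is nonnegative. *)
Lemma dual_loop_injective (b : 'cV[R]_q) : b = Dl^T *m (Dzw^T *m b) -> b = 0.
Proof.
move=> bE; apply: dotv_eq0; apply/eqP; rewrite eq_le dotv_ge0 andbT.
have := dual (_ : dual_interconnected 0 b 0).
rewrite /dual_interconnected !mulmx0 add0r !addr0 => /(_ bE).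
rewrite [X in _ <= X + _]/qform !dot0v !add0r => le0.
have h1 := posdef_ge0 (Cz^T *m b) pX.
have h2 : 0 <= gamma ^- 2 * dotv (Dzd^T *m b) (Dzd^T *m b).
  by rewrite mulr_ge0 ?dotv_ge0// invr_ge0 exprn_ge0// ltW.
rewrite -(pmulr_rle0 _ eps_gt0); lra.
Qed.

Lemma dual_loop_unitmx : 1%:M - Dl^T *m Dzw^T \in unitmx.
Proof.
apply: mulmx_ker_unit => b; rewrite mulmxBl mul1mx => /eqP.
by rewrite subr_eq0 => /eqP bE; apply: dual_loop_injective; rewrite mulmxA.
Qed.

(** Duality.  For a primal trajectory take a = X^-1 xp and c = e, and solve the
    dual loop for b.  Since the two loops are transposes of each other,
    x . xi + d . dl = V(xp) + |e|^2 for the dual outputs xi and dl; completing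
    the square of x - X xi in the norm of X^-1, and of gamma d - dl / gamma,
    bounds twice this number by V(x) + gamma^2 |d|^2 plus the left-hand side of
    the dual inequality without its margin. *)
Lemma primal_dissipation : exists2 kappa : R, 0 < kappa &
  forall x xp w z e d,
    xp = A *m x + Bw *m w + Bd *m d -> z = Cz *m x + Dzw *m w + Dzd *m d ->
    e = Ce *m x + Dew *m w + Ded *m d -> w = Dl *m z ->
    (1 + kappa) * qform (invmx X) xp + dotv e e
    <= qform (invmx X) x + gamma ^+ 2 * dotv d d.
Proof.
have [c c1 cP] := qform_le X; have c0 : 0 < c by lra.
exists (eps / c) => [|x xp w z e d xpE zE eE wE]; first exact: divr_gt0.
pose a := invmx X *m xp.
pose b := invmx (1%:M - Dl^T *m Dzw^T) *m (Dl^T *m (Bw^T *m a + Dew^T *m e)).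
have bE : dual_interconnected a b e.
  have := mulKVmx dual_loop_unitmx (Dl^T *m (Bw^T *m a + Dew^T *m e)).
  rewrite -/b mulmxBl mul1mx => /eqP; rewrite subr_eq => /eqP bE.
  rewrite /dual_interconnected {1}bE.
  by rewrite -mulmxA -mulmxDr addrAC.
have := dual bE.
set xi := A^T *m a + _ + _; set dl := Bd^T *m a + _ + _ => dualE.
(* The coupling terms dotv z b and dotv w q agree because w = Dl z and
   b = Dl^T q. *)
have pairing : dotv x xi + dotv d dl = qform (invmx X) xp + dotv e e.
  have zb : dotv z b = dotv w (Bw^T *m a + Dzw^T *m b + Dew^T *m e).
    by rewrite {1}bE wE dotv_mull.
  have : dotv xp a + dotv z b + dotv e e = dotv x xi + dotv d dl + dotv z b.
    rewrite {2}zb {1}xpE {1}zE {1}eE !dotvDl !dotvDr !dotv_mull; ring.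
  rewrite {1}/a -/(qform _ _) => E; lra.
(* c bounds the form of X, so the margin in a dominates eps / c times V(xp). *)
have aa : eps / c * qform (invmx X) xp <= eps * (dotv a a + dotv b b).
  apply: (@le_trans _ _ (eps * dotv a a)); last first.
    by rewrite ler_pM2l// lerDl dotv_ge0.
  rewrite mulrAC ler_pdivrMr// -mulrA ler_pM2l// mulrC.
  by rewrite -(qform_inv _ pX) cP.
have sx : 0 <= qform (invmx X) x - dotv x xi *+ 2 + qform X xi.
  have iX := posdef_inv pX.
  have := posdef_ge0 (x - X *m xi) iX.
  rewrite (qformB _ _ iX.1) mulKmx ?posdef_unitmx//.
  rewrite -[qform (invmx X) (X *m _)](qform_inv _ pX) mulKmx ?posdef_unitmx//.
have sd := scaled_square d dl gamma_gt0.
have aX : qform X a = qform (invmx X) xp by rewrite qform_inv.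
rewrite aX in dualE; rewrite mulrDl mul1r.
move: sx sd dualE aa pairing; rewrite !mulr2n.
move: (eps / c * _) (eps * _) (gamma ^- 2 * _) (gamma ^+ 2 * _) => r1 r2 r3 r4.
lra.
Qed.

End Duality.

(** * The multipliers as dual quadratic constraints *)

Section Multipliers.
Variable R : realType.

Lemma stack_colN k m n (f : 'I_k -> 'M[R]_(m, n)) :
  - stack_col f = stack_col (fun i => - f i).
Proof. by apply/matrixP => i j; rewrite !mxE. Qed.

Lemma qform_lifted_multiplier s nz nw (Q : 'M[R]_nz) (S : 'M[R]_(nz, nw))
    (T : 'M[R]_nw) (u : 'I_s -> 'cV[R]_nz) (v : 'I_s -> 'cV[R]_nw) :
  qform (lifted_multiplier s Q S T) (col_mx (stack_col u) (stack_col v)) =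
  \sum_i qform (block_mx Q S S^T T) (col_mx (u i) (v i)).
Proof.
rewrite /qform /lifted_multiplier mul_block_col !tens1_mul !stack_colD.
rewrite dotv_col !dotv_stack -big_split; apply: eq_bigr => i _.
by rewrite mul_block_col dotv_col.
Qed.

(** The i-th pair of blocks is, up to sign, (-Delta^T; 1) applied to the i-th
    block of q, and the lifted form is a sum over i. *)
Lemma lifted_multiplier_le0 s nz nw (Q : 'M[R]_nz) (S : 'M[R]_(nz, nw))
    (T : 'M[R]_nw) (Delta : 'M[R]_(nw, nz)) (q : 'cV[R]_(s * nw)) :
  negsemidefmx ((col_mx (- Delta^T) 1%:M)^T *m block_mx Q S S^T T
                *m col_mx (- Delta^T) 1%:M) ->
  qform (lifted_multiplier s Q S T)
        (col_mx (tensmx (1%:M : 'M[R]_s) Delta^T *m q) (- q)) <= 0.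
Proof.
move=> nP; have [f ->] := stack_col_surj q.
rewrite tens1_mul stack_colN qform_lifted_multiplier; apply: sumr_le0 => i _.
have := negsemidefmxE (f i) nP; rewrite qform_congr -qform_opp.
by rewrite mul_col_mx mul1mx mulNmx opp_col_mx opprK.
Qed.

Lemma gain_multiplier_inv nn nr ne s (gamma : R) : 0 < gamma ->
  invmx (gain_multiplier nn nr ne s gamma)
  = diag2_mx 1%:M (- gamma ^- 2)%:M.
Proof.
move=> g0; set B := RHS.
have AB : gain_multiplier nn nr ne s gamma *m B = 1%:M.
  rewrite /gain_multiplier /B /diag2_mx mulmx_block !mulmx0 !mul0mx !addr0 add0r.
  rewrite mul1mx -scalar_mxM mulrNN divff ?expf_neq0 ?gt_eqF//.
  by rewrite -scalar_mx_block.
have [uA _] := mulmx1_unit AB.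
by rewrite -[LHS]mulmx1 -AB mulKmx.
Qed.

Lemma qform_scalar m a (v : 'cV[R]_m) : qform a%:M v = a * dotv v v.
Proof. by rewrite /qform mul_scalar_mx dotvZr. Qed.

End Multipliers.

Section DataMultiplier.
Variables (R : realType) (nx nw nz nn nr ne ny : nat).
Variables (G : plant R nx nw nz nn nr ne ny) (h : nat).
Variables (xs : 'cV[R]_nx) (rs : 'cV[R]_(h * nr)) (ys : 'cV[R]_(h * ny)).
Variable (ns : 'cV[R]_(h * nn)).

Local Notation A := (mA G).

(** The responses of z and y to the initial state and the inputs n and r with
    w = 0; the first depends on the unknown noise and is never measured. *)
Definition free_z : 'cV[R]_(h * nz) :=
  hatC h A (mCz G) *m xs + hatD h A (mBn G) (mCz G) (mDzn G) *m ns
  + hatD h A (mBr G) (mCz G) (mDzr G) *m rs.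

Definition free_y : 'cV[R]_(h * ny) :=
  hatC h A (mCy G) *m xs + hatD h A (mBn G) (mCy G) (mDyn G) *m ns
  + hatD h A (mBr G) (mCy G) (mDyr G) *m rs.

(** The lower part of W v is by construction minus the transposed noise response
    applied to (v1, v2).  The hypothesis is what makes the upper, scalar, part
    equal to the one prescribed by -ns^T. *)
Lemma dataW_mul (v1 : 'cV[R]_(h * nz)) (v2 : 'cV[R]_(h * ny)) :
  dotv free_z v1 = dotv (ys - free_y) v2 ->
  dataW G xs rs ys *m col_mx v1 v2 =
  col_mx (- ns^T) 1%:M *m
    - ((hatD h A (mBn G) (mCz G) (mDzn G))^T *m v1
       + (hatD h A (mBn G) (mCy G) (mDyn G))^T *m v2).
Proof.
move=> orth; rewrite /dataW -mulmxA !(mul_col_mx, mul_row_col, mul0mx, mul1mx).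
rewrite !(tr_col_mx, tr_row_mx, trmx0, trmx1) !mul_row_col !mul_col_mx.
rewrite !mul0mx !add_col_mx mul1mx !add0r !addr0 !mulNmx -!opprD.
congr col_mx; apply/colP => i; rewrite !ord1.
have entryD (M N : 'M[R]_1) : (M + N) 0 0 = M 0 0 + N 0 0 by rewrite mxE.
have entryN (M : 'M[R]_1) : (- M) 0 0 = - M 0 0 by rewrite mxE.
rewrite !mulmxN !(entryD, entryN) !mulmxDr !entryD -!/(dotv _ _).
move: orth; rewrite /free_z /free_y !dotvDl dotvNl !dotvDl !dotv_mull; lra.
Qed.

End DataMultiplier.

(** * The LMI along the dual loop *)

Lemma eq_mulmx_cV (R : realType) m n (M N : 'M[R]_(m, n)) :
  (forall v : 'cV_n, M *m v = N *m v) -> M = N.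
Proof.
move=> MN; apply/matrixP => i j; have := MN (delta_mx j 0).
by rewrite -!colE => /colP /(_ i); rewrite !mxE.
Qed.

(** v and mpinv M M v have the same image under M, hence under L. *)
Lemma mpinv_factor (R : realType) m n p (M : 'M[R]_(m, n)) (L : 'M[R]_(p, n)) :
  rker M `<=` rker L -> L *m mpinv M *m M = L.
Proof.
move=> kML; apply: eq_mulmx_cV => v; apply/eqP; rewrite eq_sym -subr_eq0.
have [MM _ _ _] := penrose_mpinv M.
have /kML : rker M (v - mpinv M *m (M *m v)).
  by rewrite /rker /= mulmxBr !mulmxA MM subrr.
by rewrite /rker /= mulmxBr !mulmxA => ->.
Qed.

Section DualInequality.
Variables (R : realType) (nx nw nz nn nr ne ny : nat).
Variables (G : plant R nx nw nz nn nr ne ny) (Delta : 'M[R]_(nw, nz)).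
Variables (h s : nat) (s_leh : (s <= h)%N).

Local Notation A := (mA G).
Local Notation Bws := (hatB s A (mBw G)).
Local Notation Bds := (hatB s A (mBd G)).
Local Notation Czs := (hatC s A (mCz G)).
Local Notation Ces := (hatC s A (mCe G)).
Local Notation Dzws := (hatD s A (mBw G) (mCz G) (mDzw G)).
Local Notation Dzds := (hatD s A (mBd G) (mCz G) (mDzd G)).
Local Notation Dews := (hatD s A (mBw G) (mCe G) (mDew G)).
Local Notation Deds := (hatD s A (mBd G) (mCe G) (mDed G)).
Local Notation Ds := (tensmx (1%:M : 'M[R]_s) Delta).

Lemma outer_factor_mul (a : 'cV[R]_nx) (b : 'cV[R]_(s * nz)) (c : 'cV[R]_(s * ne)) :
  outer_factor G s_leh *m col_mx a (col_mx b c) =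
  col_mx a (col_mx (- ((A ^+ s)^T *m a + Czs^T *m b + Ces^T *m c))
  (col_mx (col_mx b (- (Bws^T *m a + Dzws^T *m b + Dews^T *m c)))
  (col_mx (col_mx ((Nmx R nz s_leh)^T *m b)
                  ((Mb G s_leh)^T *m a + (Md G s_leh)^T *m c))
          (col_mx c (- (Bds^T *m a + Dzds^T *m b + Deds^T *m c)))))).
Proof.
rewrite /outer_factor !(mul_col_mx, mul_row_col) !mul0mx !mul1mx !addr0 !add0r.
by rewrite !mulNmx -!opprD !addrA.
Qed.

Section Data.
Variables (xs : 'cV[R]_nx) (rs : 'cV[R]_(h * nr)) (ys : 'cV[R]_(h * ny)).
Variable (ns : 'cV[R]_(h * nn)).
Hypothesis hdata : data_trajectory G Delta xs rs ys ns.
Hypothesis hkerB : rker (hatDhyw G h) `<=` rker (padB G s_leh).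
Hypothesis hkerD : rker (hatDhyw G h) `<=` rker (padD G s_leh).

(** Both sides equal w . (B_w^T a + D_ew^T c), with w the recorded interconnection
    signal on the first s samples: on the right because ys - free_y = D_hyw w,
    and M_b D_hyw, M_d D_hyw are the padded B_w, D_ew; on the left because the
    first s samples of free_z are z - D_zw w, with w = D z and b = D^T q. *)
Lemma data_pairing a b c :
  dual_interconnected Bws Dzws Dews Ds a b c ->
  dotv (free_z G xs rs ns) ((Nmx R nz s_leh)^T *m b) =
  dotv (ys - free_y G xs rs ns) ((Mb G s_leh)^T *m a + (Md G s_leh)^T *m c).
Proof.
move=> bE; have [x [w [z [y [n [r [x0 nsE rsE ysE eqs]]]]]]] := hdata.
have xE k : (k < h)%N -> x k.+1 =
    A *m x k + mBw G *m w k + row_mx (mBn G) (mBr G) *m col_mx (n k) (r k).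
  by move=> /eqs[-> _ _ _]; rewrite mul_row_col !addrA.
have zE : stack_col (fun k : 'I_h => z k) = free_z G xs rs ns +
    hatD h A (mBw G) (mCz G) (mDzw G) *m stack_col (fun k : 'I_h => w k).
  rewrite (lifted_output xE (C := mCz G) (D1 := mDzw G)
    (D2 := row_mx (mDzn G) (mDzr G))) => [|k /eqs[_ -> _ _]]; last first.
    by rewrite mul_row_col !addrA.
  rewrite hatD_row_mx x0 /free_z nsE rsE.
  by rewrite -addrA (addrC (_ *m stack_col (fun k : 'I_h => w k))) !addrA.
have yE : ys = free_y G xs rs ns +
    hatDhyw G h *m stack_col (fun k : 'I_h => w k).
  rewrite ysE (lifted_output xE (C := mCy G) (D1 := mDyw G)
    (D2 := row_mx (mDyn G) (mDyr G))) => [|k /eqs[_ _ -> _]]; last first.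
    by rewrite mul_row_col !addrA.
  rewrite hatD_row_mx x0 /free_y nsE rsE.
  by rewrite -addrA (addrC (_ *m stack_col (fun k : 'I_h => w k))) !addrA.
have wE : stack_col (fun k : 'I_s => w k) = Ds *m stack_col (fun k : 'I_s => z k).
  rewrite tens1_mul; apply: eq_stack_col => k.
  by have [_ _ _ ->] := eqs k (leq_trans (ltn_ord k) s_leh).
have NE : Nmx R nz s_leh *m free_z G xs rs ns =
    stack_col (fun k : 'I_s => z k) - Dzws *m stack_col (fun k : 'I_s => w k).
  have -> := esym (addrK (hatD h A (mBw G) (mCz G) (mDzw G)
    *m stack_col (fun k : 'I_h => w k)) (free_z G xs rs ns)).
  rewrite -zE !hatD_stack mulmxBr.
  rewrite (pad_row_mul _ _ z) (pad_row_mul _ _ (fun i => mCz G *m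
    forced A (fun j => mBw G *m w j) i + mDzw G *m w i)).
  by rewrite !mul1mx.
rewrite yE addrAC subrr add0r dotvDr.
rewrite -!dotv_mull !mulmxA NE !mpinv_factor//.
rewrite !pad_row_mul dotvDl dotvNl {1}bE -dotv_mull -wE !dotvDr !dotv_mull; ring.
Qed.

End Data.
End DualInequality.

(** * Consequences of the LMI for the interconnection *)

Section Consequences.
Variables (R : realType) (nx nw nz nn nr ne ny : nat).
Variables (G : plant R nx nw nz nn nr ne ny) (Delta : 'M[R]_(nw, nz)).
Variables (s : nat) (gamma : R).

Local Notation A := (mA G).
Local Notation Ds := (tensmx (1%:M : 'M[R]_s) Delta).

Definition lifted_dual_dissipation (X : 'M[R]_nx) (eps : R) : Prop :=
  dual_dissipation (A ^+ s) (hatB s A (mBw G)) (hatB s A (mBd G))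
    (hatC s A (mCz G)) (hatD s A (mBw G) (mCz G) (mDzw G))
    (hatD s A (mBd G) (mCz G) (mDzd G)) (hatC s A (mCe G))
    (hatD s A (mBw G) (mCe G) (mDew G)) (hatD s A (mBd G) (mCe G) (mDed G))
    Ds X gamma eps.

(** Along solutions of the dual loop both multiplier terms of the LMI are
    nonpositive and can be dropped; coercivity of the LMI matrix leaves the
    margin eps. *)
Lemma lmi_dual_dissipation h (s_leh : (s <= h)%N) (xs : 'cV[R]_nx)
    (rs : 'cV[R]_(h * nr)) (ys : 'cV[R]_(h * ny)) (ns : 'cV[R]_(h * nn))
    (X : 'M[R]_nx) (Q : 'M[R]_nz) (S : 'M[R]_(nz, nw)) (T : 'M[R]_nw)
    (P : 'M[R]_(1 + h * nn)) :
  0 < gamma ->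
  data_trajectory G Delta xs rs ys ns ->
  rker (hatDhyw G h) `<=` rker (padB G s_leh) ->
  rker (hatDhyw G h) `<=` rker (padD G s_leh) ->
  negsemidefmx ((col_mx (- Delta^T) 1%:M)^T *m block_mx Q S S^T T
                *m col_mx (- Delta^T) 1%:M) ->
  negsemidefmx ((col_mx (- ns^T) 1%:M)^T *m P *m col_mx (- ns^T) 1%:M) ->
  analysis_lmi G s_leh gamma X Q S T
    ((dataW G xs rs ys)^T *m P *m dataW G xs rs ys) ->
  exists2 eps, 0 < eps & lifted_dual_dissipation X eps.
Proof.
move=> g0 hdata hB hD nP nPn /posdef_coercive[eps eps0 coer].
exists eps => // a b c bE; have := coer (col_mx a (col_mx b c)).
rewrite qform_congr outer_factor_mul !qform_diag2 gain_multiplier_inv//.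
rewrite !qform_diag2 qform1 qformN !qform_opp qform_scalar qform_congr.
rewrite (dataW_mul (data_pairing hdata hB hD bE)).
set v := - (_ *m ((Nmx R nz s_leh)^T *m b) + _).
have := negsemidefmxE v nPn; rewrite qform_congr => le1.
have := lifted_multiplier_le0 (s := s)
  ((hatB s A (mBw G))^T *m a + (hatD s A (mBw G) (mCz G) (mDzw G))^T *m b
    + (hatD s A (mBw G) (mCe G) (mDew G))^T *m c) nP.
have -> : tensmx (1%:M : 'M[R]_s) Delta^T = Ds^T by rewrite trmx_tens trmx1.
rewrite -bE !dotv_col => le2.
have cc : 0 <= eps * dotv c c by rewrite mulr_ge0 ?dotv_ge0 ?ltW.
move: le1 le2 cc; rewrite !mulrDr mulNr.
set r1 := qform P _; set r2 := qform (lifted_multiplier _ _ _ _) _.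
set r3 := gamma ^- 2 * _; set r4 := qform X (_ + _ + _).
set r5 := eps * dotv a a; set r6 := eps * dotv b b; set r7 := eps * dotv c c.
lra.
Qed.

(** The transpose of D_zw is block upper triangular, so a solution u of
    u = Delta^T Dzw^T u placed in the first of the s blocks solves the dual loop
    with a = 0 and c = 0, where only zero does. *)
Lemma well_posed X eps : (1 <= s)%N -> 0 < gamma -> 0 < eps -> posdefmx X ->
  lifted_dual_dissipation X eps -> 1%:M - mDzw G *m Delta \in unitmx.
Proof.
move=> s1 g0 e0 pX dual; rewrite -unitmx_tr; apply: mulmx_ker_unit => u.
rewrite linearB /= trmx1 trmx_mul mulmxBl mul1mx => /eqP; rewrite subr_eq0.
move=> /eqP uE; pose f (i : nat) : 'cV[R]_nz := if i == 0%N then u else 0.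
pose b := stack_col (fun i : 'I_s => f i).
have DT : (hatD s A (mBw G) (mCz G) (mDzw G))^T *m b =
    stack_col (fun i : 'I_s => if i == 0%N :> nat then (mDzw G)^T *m u else 0).
  set F := fun i j : 'I_s => (if j == i then mDzw G else
    if (i < j)%N then mCz G *m A ^+ (j - i.+1) *m mBw G else 0)^T.
  have -> : (hatD s A (mBw G) (mCz G) (mDzw G))^T = stack_block F.
    by apply/matrixP => i j; rewrite !mxE.
  rewrite stack_block_mul; apply: eq_stack_col => i.
  pose i0 := Ordinal s1; rewrite (bigD1 i0)//= big1 => [|j j0]; last first.
    by rewrite /f -(inj_eq val_inj) /= in j0 *; rewrite (negbTE j0) mulmx0.
  rewrite addr0 /F /f /= -(inj_eq val_inj) /= eq_sym.
  by case: eqP => // _; rewrite ?ltn0 trmx0 mul0mx.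
have b0 : b = 0.
  apply: (dual_loop_injective pX g0 e0 dual); rewrite DT trmx_tens trmx1 tens1_mul.
  by apply: eq_stack_col => i; rewrite /f; case: eqP; rewrite ?mulmx0// mulmxA.
have : dotv b b = 0 by rewrite b0 dotv0.
rewrite dotv_stack => /eqP; rewrite psumr_eq0 => [/allP|i _]; last exact: dotv_ge0.
move=> /(_ (Ordinal s1) (mem_index_enum _)) /=.
by rewrite /f eqxx => /eqP /dotv_eq0.
Qed.

Definition window_dissipative (V : 'cV[R]_nx -> R) (kappa : R) : Prop :=
  forall x w z e y n r, interconnection G Delta x w z e y n r -> forall k,
    (1 + kappa) * V (x (k + s)%N) + \sum_(i < s) dotv (e (k + i)%N) (e (k + i)%N)
    <= V (x k) + gamma ^+ 2 * \sum_(i < s)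
         (dotv (n (k + i)%N) (n (k + i)%N) + dotv (r (k + i)%N) (r (k + i)%N)).

Lemma dual_window_dissipative X eps :
  0 < gamma -> 0 < eps -> posdefmx X -> lifted_dual_dissipation X eps ->
  exists2 kappa, 0 < kappa & window_dissipative (qform (invmx X)) kappa.
Proof.
move=> g0 e0 pX /(primal_dissipation pX g0 e0)[kappa k0 prim].
exists kappa => // x w z e y n r eqs k.
pose d i := col_mx (n (k + i)%N) (r (k + i)%N).
have xE i : (i < s)%N -> x (k + i.+1)%N =
    A *m x (k + i)%N + mBw G *m w (k + i)%N + mBd G *m d i.
  by have [xE _ _ _ _] := eqs (k + i)%N; rewrite addnS xE mul_row_col !addrA.
have zE i : (i < s)%N -> z (k + i)%N =
    mCz G *m x (k + i)%N + mDzw G *m w (k + i)%N + mDzd G *m d i.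
  by have [_ zE _ _ _] := eqs (k + i)%N; rewrite zE mul_row_col !addrA.
have eE i : (i < s)%N -> e (k + i)%N =
    mCe G *m x (k + i)%N + mDew G *m w (k + i)%N + mDed G *m d i.
  by have [_ _ eE _ _] := eqs (k + i)%N; rewrite eE mul_row_col !addrA.
have wE : stack_col (fun i : 'I_s => w (k + i)%N) =
    Ds *m stack_col (fun i : 'I_s => z (k + i)%N).
  by rewrite tens1_mul; apply: eq_stack_col => i; have [_ _ _ _ ->] := eqs (k + i)%N.
have := prim _ _ _ _ _ _ (lifted_state (x := fun i => x (k + i)%N) xE)
  (lifted_output (x := fun i => x (k + i)%N) (o := fun i => z (k + i)%N) xE zE)
  (lifted_output (x := fun i => x (k + i)%N) (o := fun i => e (k + i)%N) xE eE) wE.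
rewrite !dotv_stack addn0 => h; apply: le_trans h _.
by rewrite lerD2l ler_pM2l ?exprn_gt0//; apply: ler_sum => i _; rewrite dotv_col.
Qed.

End Consequences.

(** * Exponential decay of sampled sequences *)

Section GeometricDecay.
Variable R : realType.

(** V decays by 1 + kappa every s steps and bounds a on both sides; between
    the samples a grows at most by the factor L ^ s.  The rate is chosen with
    exp (alpha s) = 1 + kappa; C depends on the constants only, as uniformity
    over trajectories requires. *)
Lemma sampled_exponential_decay (s : nat) (kappa L c1 c2 : R) :
  (1 <= s)%N -> 0 < kappa -> 1 <= L -> 0 < c1 -> 0 < c2 ->
  exists C alpha : R, [/\ 0 < C, 0 < alpha & forall a V : nat -> R,
    (forall t, 0 <= a t) ->
    (forall t, c1 * a t <= V t) -> (forall t, V t <= c2 * a t) ->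
    (forall t, a t.+1 <= L * a t) ->
    (forall t, (1 + kappa) * V (t + s)%N <= V t) ->
    forall t, a t <= C * expR (- alpha * t%:R) * a 0%N].
Proof.
move=> s1 k0 L1 c10 c20.
have s0 : 0 < s%:R :> R by rewrite ltr0n.
pose alpha : R := ln (1 + kappa) / s%:R.
have a0 : 0 < alpha by rewrite divr_gt0// ln_gt0// ltrDl.
have ek : expR (alpha * s%:R) = 1 + kappa.
  by rewrite /alpha divfK ?gt_eqF// lnK// posrE; lra.
exists (L ^+ s * c1^-1 * (1 + kappa) * c2), alpha; split=> //.
  by rewrite !mulr_gt0 ?exprn_gt0 ?invr_gt0//; lra.
move=> a V age0 lo up step dec t.
have Vm m : (1 + kappa) ^+ m * V (m * s)%N <= V 0%N.
  elim: m => [|m IH]; first by rewrite expr0 mul1r mul0n.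
  apply: le_trans IH; rewrite exprSr -mulrA ler_pM2l ?exprn_gt0//; last lra.
  by rewrite mulSn addnC.
have aj k j : a (k + j)%N <= L ^+ j * a k.
  elim: j => [|j IH]; first by rewrite addn0 expr0 mul1r.
  rewrite addnS; apply: (le_trans (step _)); rewrite exprS -mulrA ler_pM2l//; lra.
set m := (t %/ s)%N.
rewrite mulNr expRN mulrAC ler_pdivlMr ?expR_gt0//.
(* Rounding t up to a multiple of s costs one extra factor 1 + kappa in C. *)
have tm : alpha * t%:R <= alpha * s%:R * m.+1%:R.
  rewrite -mulrA ler_pM2l// -natrM ler_nat mulnC; exact/ltnW/ltn_ceil.
have et : expR (alpha * t%:R) <= (1 + kappa) ^+ m.+1.
  by rewrite -ek -expRM_natr ler_expR.
have at1 : a t <= L ^+ s * a (m * s)%N.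
  rewrite {1}(divn_eq t s); apply: (le_trans (aj _ _)).
  by rewrite ler_wpM2r// ler_weXn2l// ltnW// ltn_pmod.
have at2 : a (m * s)%N <= c1^-1 * V (m * s)%N by rewrite ler_pdivlMl.
apply: (@le_trans _ _ (L ^+ s * (c1^-1 * V (m * s)%N) * (1 + kappa) ^+ m.+1)).
  apply: ler_pM => //; rewrite ?expR_ge0//.
  by apply: (le_trans at1); rewrite ler_pM2l// exprn_gt0//; lra.
have -> : L ^+ s * (c1^-1 * V (m * s)%N) * (1 + kappa) ^+ m.+1 =
    L ^+ s * c1^-1 * (1 + kappa) * ((1 + kappa) ^+ m * V (m * s)%N).
  by rewrite exprS; ring.
rewrite -[leRHS]mulrA ler_pM2l; last first.
  by rewrite !mulr_gt0 ?exprn_gt0 ?invr_gt0//; lra.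
exact: le_trans (Vm m) (up 0%N).
Qed.

End GeometricDecay.

(** * Comparison of signal energies *)

Section Performance.
Variable R : realType.

Lemma l2norm_ge0 m (u : nat -> 'cV[R]_m) : (0 <= l2norm u)%E.
Proof. exact: sqrte_ge0. Qed.

Lemma l2norm_gt0 m (u : nat -> 'cV[R]_m) : u <> (fun=> 0) -> (0 < l2norm u)%E.
Proof.
move=> u0; rewrite lt0e l2norm_ge0 andbT; apply/eqP => nu0; apply: u0.
apply/funext => k; apply: dotv_eq0; apply/eqP; rewrite eq_le dotv_ge0 andbT.
have s0 : (0 <= \sum_(0 <= k <oo) ((norm2 (u k)) ^+ 2)%:E)%E.
  by apply: nneseries_ge0 => i _ _; rewrite lee_fin sqr_ge0.
have e0 : (\sum_(0 <= k <oo) ((norm2 (u k)) ^+ 2)%:E = 0)%E.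
  by rewrite -(sqr_sqrte s0) -/(l2norm u) nu0 expe2 mul0e.
rewrite -lee_fin -sqr_norm2 -[X in (_ <= X)%E]e0.
apply: le_trans (nneseries_lim_ge k.+1 _) => [|i _ _]; last by rewrite lee_fin sqr_ge0.
rewrite big_nat_recr//= leeDr// sume_ge0// => i _; by rewrite lee_fin sqr_ge0.
Qed.

(** The energies are compared at multiples of s only; this suffices because
    partial sums of squares are nondecreasing. *)
Lemma l2norm_le m1 m2 (e : nat -> 'cV[R]_m1) (d : nat -> 'cV[R]_m2) (gamma : R)
    (s : nat) : (1 <= s)%N -> 0 < gamma ->
  (forall m, \sum_(0 <= k < m * s) dotv (e k) (e k)
             <= gamma ^+ 2 * \sum_(0 <= k < m * s) dotv (d k) (d k)) ->
  (l2norm e <= gamma%:E * l2norm d)%E.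
Proof.
move=> s1 g0 ed; rewrite /l2norm.
set Sd := (\sum_(0 <= k <oo) ((norm2 (d k)) ^+ 2)%:E)%E.
have Sd0 : (0 <= Sd)%E by apply: nneseries_ge0 => i _ _; rewrite lee_fin sqr_ge0.
have -> : gamma%:E = sqrte (gamma ^+ 2)%:E by rewrite /= sqrtr_sqr gtr0_norm.
rewrite -sqrteM ?lee_fin ?sqr_ge0// lee_sqrt ?mule_ge0 ?lee_fin ?sqr_ge0//.
apply: lime_le.
  by apply: is_cvg_nneseries => i _ _; rewrite lee_fin sqr_ge0.
apply: nearW => N.
apply: (@le_trans _ _ (\sum_(0 <= k < N * s) ((norm2 (e k)) ^+ 2)%:E)%E).
  have Ns : (N <= N * s)%N by rewrite leq_pmulr.
  rewrite (big_cat_nat _ Ns)//= leeDl// sume_ge0// => i _.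
  by rewrite lee_fin sqr_ge0.
apply: (@le_trans _ _
  ((gamma ^+ 2)%:E * \sum_(0 <= k < N * s) ((norm2 (d k)) ^+ 2)%:E)%E).
  have sqE m (u : nat -> 'cV[R]_m) n : \sum_(0 <= k < n) norm2 (u k) ^+ 2 =
      \sum_(0 <= k < n) dotv (u k) (u k).
    by apply: eq_bigr => k _; exact: sqr_norm2.
  by rewrite !sumEFin -EFinM lee_fin !sqE.
rewrite lee_pmul2l ?lte_fin ?exprn_gt0//.
by apply: nneseries_lim_ge => i _ _; rewrite lee_fin sqr_ge0.
Qed.

End Performance.

(** * Stability and energy gain *)

Section Conclusion.
Variables (R : realType) (nx nw nz nn nr ne ny : nat).
Variables (G : plant R nx nw nz nn nr ne ny) (Delta : 'M[R]_(nw, nz)).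
Variables (s : nat) (gamma kappa : R) (Y : 'M[R]_nx).
Hypotheses (s_ge1 : (1 <= s)%N) (gamma_gt0 : 0 < gamma) (kappa_gt0 : 0 < kappa).
Hypotheses (pY : posdefmx Y).
Hypothesis diss : window_dissipative G Delta s gamma (qform Y) kappa.

(** Well-posedness makes the unforced loop an autonomous linear recursion. *)
Lemma one_step_growth : 1%:M - mDzw G *m Delta \in unitmx ->
  exists2 L : R, 1 <= L & forall x w z e y,
    interconnection G Delta x w z e y (fun=> 0) (fun=> 0) ->
    forall t, dotv (x t.+1) (x t.+1) <= L * dotv (x t) (x t).
Proof.
move=> uD.
pose F := mA G
  + mBw G *m (Delta *m (invmx (1%:M - mDzw G *m Delta) *m mCz G)).
have [L L1 LP] := qform_le (F^T *m F).
exists L => // x w z e y eqs t.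
have [xE zE _ _ wE] := eqs t.
have zt : z t = invmx (1%:M - mDzw G *m Delta) *m (mCz G *m x t).
  rewrite -[LHS](mulKmx uD); congr (_ *m _).
  rewrite mulmxBl mul1mx -mulmxA -wE {1}zE !mulmx0 !addr0.
  by rewrite addrK.
have -> : x t.+1 = F *m x t.
  by rewrite xE wE zt !mulmx0 !addr0 mulmxDl !mulmxA.
by have := LP (x t); rewrite /qform -mulmxA dotv_mulr trmxK.
Qed.

Lemma window_dissipative_stable : 1%:M - mDzw G *m Delta \in unitmx ->
  stable G Delta.
Proof.
move=> uD; split=> //.
have [L L1 stepP] := one_step_growth uD.
have [c1 c10 lo] := posdef_coercive pY; have [c2 c21 up] := qform_le Y.
have c20 : 0 < c2 by lra.
have [C [alpha [C0 a0 decay]]] :=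
  sampled_exponential_decay s_ge1 kappa_gt0 L1 c10 c20.
(* The decay is established for squared norms. *)
exists (Num.sqrt C), (alpha / 2); split; [by rewrite sqrtr_gt0|by lra|].
move=> x w z e y eqs t.
have := decay (fun t => dotv (x t) (x t)) (fun t => qform Y (x t))
  (fun t => dotv_ge0 _) (fun t => lo _) (fun t => up _) (stepP _ _ _ _ _ eqs).
have dec k : (1 + kappa) * qform Y (x (k + s)%N) <= qform Y (x k).
  have := diss eqs k.
  rewrite [X in gamma ^+ 2 * X]big1 => [|i _]; last by rewrite !dot0v addr0.
  rewrite mulr0 addr0; apply: le_trans.
  by rewrite lerDl sumr_ge0// => i _; exact: dotv_ge0.
move=> /(_ dec t) dect.
rewrite !norm2E; have e2 : expR (- alpha * t%:R) = expR (- (alpha / 2) * t%:R) ^+ 2.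
  by rewrite expr2 -expRD; congr expR; field.
rewrite e2 in dect; rewrite -(ger0_norm (expR_ge0 (- (alpha / 2) * _))) -sqrtr_sqr.
rewrite -!sqrtrM ?mulr_ge0 ?sqr_ge0 ?(ltW C0)//.
exact: ler_wsqrtr.
Qed.

(** Over m consecutive windows the storage terms telescope, and V(x(0)) = 0. *)
Lemma window_dissipative_gain : (energy_gain G Delta <= gamma%:E)%E.
Proof.
apply: ge_ereal_sup => _ [x [w [z [e [y [d [d2 d0 x0 eqs ->]]]]]]].
have sumE m : qform Y (x (m * s)%N) + \sum_(0 <= k < m * s) dotv (e k) (e k)
    <= gamma ^+ 2 * \sum_(0 <= k < m * s) dotv (d k) (d k).
  elim: m => [|m IH].
    by rewrite mul0n x0 !big_geq// mulr0 addr0 /qform dot0v.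
  have window p (u : nat -> 'cV[R]_p) : \sum_(0 <= k < m.+1 * s) dotv (u k) (u k) =
      \sum_(0 <= k < m * s) dotv (u k) (u k)
      + \sum_(i < s) dotv (u (m * s + i)%N) (u (m * s + i)%N).
    rewrite (big_cat_nat (n := m * s))//= ?leq_mul2r ?leqnSn ?orbT//.
    congr (_ + _); rewrite -{1}(add0n (m * s)%N) big_addn mulSn addnK big_mkord.
    by apply: eq_bigr => i _; rewrite addnC.
  have := diss eqs (m * s)%N.
  rewrite [X in gamma ^+ 2 * X](eq_bigr (fun i : 'I_s =>
    dotv (d (m * s + i)%N) (d (m * s + i)%N))); last first.
    by move=> i _; rewrite -dotv_col vsubmxK.
  rewrite !window mulSn (addnC s) [gamma ^+ 2 * (_ + _)]mulrDr.
  have := mulr_ge0 (ltW kappa_gt0) (posdef_ge0 (x (m * s + s)%N) pY).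
  rewrite mulrDl mul1r; move: IH; lra.
have le : (l2norm e <= gamma%:E * l2norm d)%E.
  apply: (l2norm_le s_ge1 gamma_gt0) => m; apply: le_trans (sumE m).
  by rewrite lerDr posdef_ge0.
have := l2norm_gt0 d0; move: d2 le; rewrite /ell2 /=.
case: (l2norm d) => // D _ le; rewrite lte_fin => D0.
by rewrite inver gt_eqF// lee_pdivrMr.
Qed.

End Conclusion.

Theorem theorem15 (R : realType) (nx nw nz nn nr ne ny : nat)
    (G : plant R nx nw nz nn nr ne ny)
    (Deltas : set 'M[R]_(nw, nz)) (Delta : 'M[R]_(nw, nz))
    (hDelta : Deltas Delta)
    (h : nat) (h_ge1 : (1 <= h)%N)
    (xs : 'cV[R]_nx) (rs : 'cV[R]_(h * nr)) (ys : 'cV[R]_(h * ny))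
    (ns : 'cV[R]_(h * nn))
    (hdata : data_trajectory G Delta xs rs ys ns)
    (Ps : set 'M[R]_(nz + nw)) (hPs : multiplier_set Deltas Ps)
    (Pn : set 'M[R]_(1 + h * nn)) (hPn : multiplier_set [set ns] Pn)
    (s : nat) (s_ge1 : (1 <= s)%N) (s_leh : (s <= h)%N)
    (hkerB : rker (hatDhyw G h) `<=` rker (padB G s_leh))
    (hkerD : rker (hatDhyw G h) `<=` rker (padD G s_leh))
    (gamma : R) (gamma_gt0 : 0 < gamma)
    (hLMI : exists (X : 'M[R]_nx) (Q : 'M[R]_nz) (S : 'M[R]_(nz, nw))
        (T : 'M[R]_nw) (PD : 'M[R]_(h * nz + h * ny)),
      [/\ posdefmx X, symmx Q /\ symmx T, Ps (block_mx Q S S^T T),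
          data_multipliers G xs rs ys Pn PD
        & analysis_lmi G s_leh gamma X Q S T PD]) :
  stable G Delta /\ (energy_gain G Delta <= gamma%:E)%E.
Proof.
have [X [Q [S [T [_ [pX _ PsP [P PnP <-] lmi]]]]]] := hLMI.
have [_ nPs _] := hPs; have [_ nPn _] := hPn.
have [eps eps_gt0 dual] := lmi_dual_dissipation gamma_gt0 hdata hkerB hkerD
  (nPs _ _ hDelta PsP) (nPn _ _ erefl PnP) lmi.
have [kappa kappa_gt0 diss] := dual_window_dissipative gamma_gt0 eps_gt0 pX dual.
have pY := posdef_inv pX; split.
  apply: (window_dissipative_stable s_ge1 kappa_gt0 pY diss).
  exact: well_posed s_ge1 gamma_gt0 eps_gt0 pX dual.
exact: window_dissipative_gain s_ge1 gamma_gt0 kappa_gt0 pY diss.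
Qed.
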